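(* The family of spacelike cylindrical surfaces in $E_1^3$ forms a family of spacelike similar ruled surfaces with variable transformation; that is, any two spacelike cylindrical ruled surfaces in $E_1^3$ are spacelike similar ruled surfaces with variable transformation.
   Context: $E_1^3$ is $\mathbb{R}^3$ with the Lorentz metric $\langle x,y\rangle=-x_1y_1+x_2y_2+x_3y_3$. A ruled surface is parametrized with its striction curve as base curve, $\vec c(s)+v\,\vec q(s)$, where $s$ is arc length of $\vec c$ and $\vec q$ is a unit vector; its Frenet frame $\{\vec q,\vec h,\vec a\}$ (ruling, central normal = unit surface normal along the striction curve, asymptotic normal) is orthonormal. The surface is spacelike if $\vec h$ is timelike. For spacelike ruled surfaces the curvatures $k_1,k_2$ are defined by $\frac{d\vec q}{ds}=k_1\vec h$, $\frac{d\vec h}{ds}=k_1\vec q+k_2\vec a$, $\frac{d\vec a}{ds}=k_2\vec h$. The ruled surface is cylindrical if the direction of $\vec q$ is constant, i.e. $k_1=0$. Definition: two regular spacelike ruled surfaces $\vec r_\alpha(s_\alpha,v_\alpha)=\vec\alpha(s_\alpha)+v_\alpha\vec q_\alpha(s_\alpha)$ and $\vec r_\beta(s_\beta,v_\beta)=\vec\beta(s_\beta)+v_\beta\vec q_\beta(s_\beta)$, with $\vec\alpha,\vec\beta$ their striction curves and $s_\alpha,s_\beta$ the arc lengths of these, are called spacelike similar ruled surfaces with variable transformation $\lambda_\beta^\alpha$ if there exists a variable transformation $s_\alpha=\int\lambda_\beta^\alpha(s_\beta)\,ds_\beta$ of the arc lengths such that $\vec q_\alpha(s_\alpha)=\vec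 q_\beta(s_\beta)$ for all corresponding values of the parameters. All spacelike ruled surfaces satisfying this relation are called a family of spacelike similar ruled surfaces with variable transformation.
   Formalization: Two cylinders with different constant rulings (e.g. the plane x_1=0 ruled along e_2 and along e_3) are not similar as defined; it is proved that any two spacelike cylinders are similar after moving one by a linear Lorentz isometry of determinant 1. *)

(* Defs.v *)
From HB Require Import structures.
From mathcomp Require Import all_boot all_order all_algebra.
From mathcomp Require Import all_classical all_reals all_analysis.

Set Implicit Arguments.
Unset Strict Implicit.
Unset Printing Implicit Defensive.

Import Order.TTheory GRing.Theory Num.Theory.
Import numFieldNormedType.Exports.

Local Open Scope classical_set_scope.
Local Open Scope ring_scope.

Section Minkowski.
Variable R : realType.

(* Vectors of E_1^3 are row vectors; coordinate 0 is the timelike one. *)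
Definition lorentz (x y : 'rV[R]_3) : R :=
  - (x 0 0 * y 0 0) + x 0 1 * y 0 1 + x 0 2 * y 0 2.

Definition lorentz_isometry (G : 'M[R]_3) : Prop :=
  forall x y : 'rV[R]_3, lorentz (x *m G) (y *m G) = lorentz x y.

End Minkowski.

(* Only used on open sets D, where the derivatives are intrinsic to D. *)
Definition smooth_on (R : realType) (V : normedModType R) (D : set R)
    (f : R -> V) : Prop :=
  forall (n : nat) (s : R), D s -> derivable (derive1n n f) s 1.

(* The functions below are total on R but only matter for s in rs_dom. *)
Record ruled_surface (R : realType) := RuledSurface {
  rs_dom : interval R;          (* range of the parameter s *)
  rs_base : R -> 'rV[R]_3;      (* base curve c *)
  rs_q : R -> 'rV[R]_3;         (* ruling *)
  rs_h : R -> 'rV[R]_3;         (* central normal *)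
  rs_a : R -> 'rV[R]_3;         (* asymptotic normal *)
  rs_k1 : R -> R;
  rs_k2 : R -> R
}.

Section RuledSurfaces.
Variable R : realType.
Implicit Types S : ruled_surface R.

Definition rs_map S (s v : R) : 'rV[R]_3 := rs_base S s + v *: rs_q S s.

Definition rs_ds S (s v : R) : 'rV[R]_3 := derive1 (fun t => rs_map S t v) s.
Definition rs_dv S (s v : R) : 'rV[R]_3 := derive1 (fun w => rs_map S s w) v.

Definition regular_surface S : Prop :=
  forall s v, s \in rs_dom S -> row_free (col_mx (rs_ds S s v) (rs_dv S s v)).

(* The base curve is the striction curve, parametrized by arc length. *)
Definition striction_arclength S : Prop :=
  forall s, s \in rs_dom S ->
    lorentz (derive1 (rs_base S) s) (derive1 (rs_q S) s) = 0 /\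
    `| lorentz (derive1 (rs_base S) s) (derive1 (rs_base S) s) | = 1.

(* Orthonormal frame whose vector h is timelike and normal to the surface
   along the curve v = 0; q and a are then spacelike. *)
Definition spacelike_frame S : Prop :=
  forall s, s \in rs_dom S ->
    [/\ [/\ lorentz (rs_q S s) (rs_q S s) = 1,
            lorentz (rs_h S s) (rs_h S s) = - 1 &
            lorentz (rs_a S s) (rs_a S s) = 1],
        [/\ lorentz (rs_q S s) (rs_h S s) = 0,
            lorentz (rs_q S s) (rs_a S s) = 0 &
            lorentz (rs_h S s) (rs_a S s) = 0] &
        lorentz (rs_h S s) (rs_ds S s 0) = 0 /\
        lorentz (rs_h S s) (rs_dv S s 0) = 0].

Definition frenet_equations S : Prop :=
  forall s, s \in rs_dom S ->
    [/\ derive1 (rs_q S) s = rs_k1 S s *: rs_h S s,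
        derive1 (rs_h S) s = rs_k1 S s *: rs_q S s + rs_k2 S s *: rs_a S s &
        derive1 (rs_a S) s = rs_k2 S s *: rs_h S s].

Definition spacelike_ruled S : Prop :=
  [/\ open [set` rs_dom S] /\ [set` rs_dom S] !=set0,
      [/\ smooth_on [set` rs_dom S] (rs_base S),
          smooth_on [set` rs_dom S] (rs_q S),
          smooth_on [set` rs_dom S] (rs_h S) &
          smooth_on [set` rs_dom S] (rs_a S)],
      regular_surface S /\ striction_arclength S,
      spacelike_frame S &
      frenet_equations S].

(* k1 = 0, that is, q is constant. *)
Definition cylindrical S : Prop :=
  forall s, s \in rs_dom S -> rs_k1 S s = 0.

(* phi : J -> I is a change of parameter s_alpha = phi s_beta which is an
   integral of lambda. *)
Definition variable_transformation (I J : interval R) (lambda phi : R -> R)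
    : Prop :=
  [/\ smooth_on [set` J] lambda,
      forall s, s \in J -> lambda s != 0,
      forall s, s \in J -> is_derive s 1 phi (lambda s) &
      set_bij [set` J] [set` I] phi].

Definition spacelike_similar (Sa Sb : ruled_surface R) : Prop :=
  [/\ spacelike_ruled Sa, spacelike_ruled Sb &
      exists lambda phi : R -> R,
        variable_transformation (rs_dom Sa) (rs_dom Sb) lambda phi /\
        forall s, s \in rs_dom Sb -> rs_q Sa (phi s) = rs_q Sb s].

(* Image of S under a linear Lorentz isometry. spacelike_similar demands equal
   rulings, so two cylinders whose constant rulings differ are similar only
   after such a motion; translations do not act on rulings. *)
Definition rs_move (G : 'M[R]_3) S : ruled_surface R :=
  RuledSurface (rs_dom S)
    (fun s => rs_base S s *m G) (fun s => rs_q S s *m G)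
    (fun s => rs_h S s *m G) (fun s => rs_a S s *m G)
    (rs_k1 S) (rs_k2 S).

End RuledSurfaces.

(* Main.v *)
Require Import Defs.
From mathcomp Require Import all_boot all_order all_algebra.
From mathcomp Require Import all_classical all_reals all_analysis.
From mathcomp Require Import ring lra.

(** A spacelike cylinder has k1 = 0, so the Frenet equation q' = k1 h says that
    its ruling q has zero derivative, hence is one fixed unit vector on the
    parameter interval (cylindrical_ruling_cst). Similarity of two cylinders
    therefore asks for two unrelated things.

    - A motion that carries the constant ruling of the first cylinder to that
      of the second. A frame (h, q, a) with h timelike is, written as the rows
      of a matrix, a Lorentz isometry taking the standard basis to the frame;
      replacing a by -a if necessary, it has determinant 1
      (exists_frame_isometry). If Fa and Fb are such matrices for the two
      cylinders, then Fa^-1 Fb is an isometry of determinant 1 with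
      qa Fa^-1 Fb = qb. Every condition defining a spacelike ruled surface is
      expressed by derivatives and Lorentz products, and a constant isometry
      commutes with the former and preserves the latter
      (spacelike_ruled_move).

    - A smooth change of parameter between the two domains. Since both rulings
      are constant, any one will do, so it suffices that two nonempty open
      intervals are always diffeomorphic (open_itv_diffeomorphic). Being
      diffeomorphic is symmetric and transitive, and each of the four shapes of
      open interval is sent onto ]0, +oo[ by an elementary function:
      (s - a) / (b - s), s - a, b - s, or the exponential. *)

Set Implicit Arguments.
Unset Strict Implicit.
Unset Printing Implicit Defensive.

Import Order.TTheory GRing.Theory Num.Theory.
Import numFieldNormedType.Exports.

Local Open Scope ring_scope.
Local Open Scope classical_set_scope.

(** * Calculus of smooth functions on an open set *)

Section SmoothOn.
Variables (R : realType) (D : set R).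
Hypothesis openD : open D.

Lemma open_near_eq (V : normedModType R) (f g : R -> V) s :
  {in D, f =1 g} -> D s -> \near s, f s = g s.
Proof.
move=> fg Ds; have := open_nbhs_nbhs (conj openD Ds).
by apply: filterS => x Dx; apply: fg; rewrite inE.
Qed.

Lemma is_derive_derive1 (V : normedModType R) (f : R -> V) s df :
  is_derive s (1 : R) f df -> f^`() s = df.
Proof. by move=> [_ <-]; rewrite derive1E. Qed.

Lemma derivable_is_derive1 (V : normedModType R) (f : R -> V) s :
  derivable f s 1 -> is_derive s (1 : R) f (f^`() s).
Proof. by move=> /derivableP; rewrite derive1E. Qed.

Lemma eq_derive1n (V : normedModType R) (f g : R -> V) n :
  {in D, f =1 g} -> {in D, f^`(n) =1 g^`(n)}.
Proof.
move=> fg; elim: n => [//|n IHn] s; rewrite inE => Ds.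
by rewrite !derive1nS !derive1E; apply/near_eq_derive/open_near_eq.
Qed.

(** Smoothness is stable under products, inverses and compositions, but the
    derivative of, say, a product mixes the factors with their derivatives, so
    an induction needs to count orders: the derivative of an (n+1)-times
    differentiable function is only known to be differentiable n times. *)
Definition diff_times (V : normedModType R) n (f : R -> V) :=
  forall k s, (k < n)%N -> D s -> derivable (f^`(k)) s 1.

Lemma smooth_diff_times (V : normedModType R) (f : R -> V) :
  smooth_on D f <-> forall n, diff_times n f.
Proof. by split=> [sf n k s _|df n s]; [apply: sf|apply: df (ltnSn n)]. Qed.

Lemma eq_diff_times (V : normedModType R) n (f g : R -> V) :
  {in D, f =1 g} -> diff_times n f -> diff_times n g.
Proof.
move=> fg df k s kn Ds; apply: near_eq_derivable (df k s kn Ds).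
exact: open_near_eq (eq_derive1n _ fg) Ds.
Qed.

Lemma diff_times0 (V : normedModType R) (f : R -> V) : diff_times 0 f.
Proof. by []. Qed.

(** The introduction rule on which all closure properties below rest: it lets
    the derivative be given in whatever form computation produces it. *)
Lemma diff_timesS (V : normedModType R) n (f g : R -> V) :
  (forall s, D s -> is_derive s (1 : R) f (g s)) ->
  diff_times n g -> diff_times n.+1 f.
Proof.
move=> fg dg; have eg : {in D, g =1 f^`()}.
  by move=> s; rewrite inE => /fg /is_derive_derive1.
move=> [|k] s kn Ds; first by case: (fg s Ds).
by rewrite derive1Sn; apply: eq_diff_times eg dg _ _ kn Ds.
Qed.

Lemma diff_timesSP (V : normedModType R) n (f : R -> V) :
  diff_times n.+1 f ->
  (forall s, D s -> is_derive s (1 : R) f (f^`() s)) /\ diff_times n f^`().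
Proof.
move=> df; split=> [s Ds|k s kn Ds].
  exact/derivable_is_derive1/(df 0%N).
by rewrite -derive1Sn; apply: df.
Qed.

Lemma diff_timesW (V : normedModType R) n (f : R -> V) :
  diff_times n.+1 f -> diff_times n f.
Proof. by move=> df k s kn; apply: df; rewrite ltnS ltnW. Qed.

Lemma smooth_on_derivable (V : normedModType R) (f : R -> V) s :
  smooth_on D f -> D s -> derivable f s 1.
Proof. by move=> sf Ds; exact: (sf 0%N). Qed.

Lemma diff_times_cst (V : normedModType R) (c : V) n :
  diff_times n (cst c : R -> V).
Proof.
elim: n c => [|n IHn] c; first by [].
by apply: (diff_timesS (g := cst 0)).
Qed.

Lemma diff_timesD n (f g : R -> R) :
  diff_times n f -> diff_times n g -> diff_times n (fun s => f s + g s).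
Proof.
elim: n f g => [f g _ _|n IHn f g].
  exact: diff_times0.
move=> /diff_timesSP[ff' df'].
move=> /diff_timesSP[gg' dg'].
apply: diff_timesS (IHn _ _ df' dg') => s Ds.
exact: (is_deriveD (ff' s Ds) (gg' s Ds)).
Qed.

Lemma diff_timesM n (f g : R -> R) :
  diff_times n f -> diff_times n g -> diff_times n (fun s => f s * g s).
Proof.
elim: n f g => [f g _ _|n IHn f g df dg]; first exact: diff_times0.
have [ff' df'] := diff_timesSP df; have [gg' dg'] := diff_timesSP dg.
apply: diff_timesS (diff_timesD (IHn _ _ (diff_timesW df) dg')
                                (IHn _ _ (diff_timesW dg) df')) => s Ds.
exact: (is_deriveM (ff' s Ds) (gg' s Ds)).
Qed.

Lemma diff_timesV n (f : R -> R) : (forall s, D s -> f s != 0) ->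
  diff_times n f -> diff_times n (fun s => (f s)^-1).
Proof.
move=> f0; elim: n => [_|n IHn df]; first exact: diff_times0.
have [ff' df'] := diff_timesSP df; have dV := IHn (diff_timesW df).
(* (1 / f)' = - 1 * (1 / f * 1 / f) * f' *)
have dN : diff_times n (cst (-1) : R -> R) := @diff_times_cst R (-1) n.
have := diff_timesM (diff_timesM dN (diff_timesM dV dV)) df'.
apply: diff_timesS => s Ds.
apply: is_derive_eq; first exact: is_deriveV (f0 s Ds) (ff' s Ds).
by rewrite expr2 invfM /GRing.scale /= mulN1r.
Qed.

Lemma smooth_on_expR : smooth_on D (@expR R).
Proof.
apply/smooth_diff_times; elim=> [|n IHn]; first exact: diff_times0.
by apply: diff_timesS IHn => s _; exact: is_derive_expR.
Qed.

End SmoothOn.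

Lemma diff_times_comp (R : realType) (D E : set R) n (u g : R -> R) :
  open D -> open E -> (forall s, D s -> E (u s)) ->
  diff_times D n u -> diff_times E n g -> diff_times D n (g \o u).
Proof.
move=> oD oE DE; elim: n g => [g _ _|n IHn g du]; first exact: diff_times0.
move=> /(diff_timesSP)[gg' dg'].
have [uu' du'] := diff_timesSP du.
apply: diff_timesS (diff_timesM oD (IHn _ (diff_timesW du) dg') du') => // s Ds.
by apply: is_derive1_comp; auto.
Qed.

(** * Diffeomorphisms between open intervals *)

(** The derivative lambda of phi is part of the data, and is allowed to be
    negative: this is a variable transformation stated for sets, where the way
    an interval is written does not matter. *)
Definition diffeomorphic (R : realType) (D E : set R) :=
  exists lambda phi : R -> R,
    [/\ smooth_on D lambda, forall s, D s -> lambda s != 0,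
        forall s, D s -> is_derive s 1 phi (lambda s) & set_bij D E phi].

Section Diffeomorphic.
Variable R : realType.
Implicit Types D E F : set R.

Lemma diffeomorphic_trans D E F : open D -> open E ->
  diffeomorphic D E -> diffeomorphic E F -> diffeomorphic D F.
Proof.
move=> oD oE [l [p [sl l0 pl bp]]] [m [r [sm m0 rm br]]].
have DE s : D s -> E (p s) by case: bp => + _ _; apply.
exists (fun s => m (p s) * l s), (r \o p); split.
- apply/smooth_diff_times => n.
  have dl := (smooth_diff_times _ _).1 sl n.
  have dm := (smooth_diff_times _ _).1 sm n.
  have dp : diff_times D n p := diff_timesW (diff_timesS oD pl dl).
  have dmp : diff_times D n (m \o p) := diff_times_comp oD oE DE dp dm.
  exact: (diff_timesM oD dmp dl).
- by move=> s Ds; rewrite mulf_neq0 ?l0 ?m0//; apply: DE.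
- by move=> s Ds; apply: is_derive1_comp; [apply/rm/DE|apply: pl].
- exact: set_bij_comp bp br.
Qed.

(** The inverse r of phi has derivative 1 / lambda(r), an expression in r
    itself. So r is smooth by bootstrapping: if r is n times differentiable,
    so is its derivative, and r is n + 1 times differentiable. *)
Lemma diffeomorphic_sym D E : open D -> open E ->
  diffeomorphic D E -> diffeomorphic E D.
Proof.
move=> oD oE [l [p [sl l0 pl bp]]].
pose r t := xget 0 [set s | D s /\ p s = t].
have rP t : E t -> D (r t) /\ p (r t) = t.
  move=> Et; apply: (xgetPex 0 (P := [set s | D s /\ p s = t])).
  by case: bp => _ _ /(_ t Et) [s Ds pst]; exists s.
have pD s : D s -> E (p s) by case: bp => + _ _; apply.
have rK s : D s -> r (p s) = s.
  move=> Ds; have [Dr pr] := rP _ (pD _ Ds).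
  by case: bp => _ inj _; apply: inj; rewrite ?inE.
have rl t : E t -> is_derive t 1 r (l (r t))^-1.
  move=> Et; have [Dr pr] := rP t Et.
  have nD := open_nbhs_nbhs (conj oD Dr).
  rewrite -{1}pr; apply: is_derive_inverse (pl _ Dr) (l0 _ Dr).
  - by apply: filterS nD => s /rK.
  - apply: filterS nD => s /pl[ps _].
    exact/differentiable_continuous/derivable1_diffP.
exists (fun t => (l (r t))^-1), r; split => //.
- apply/smooth_diff_times; elim=> [|n IHn]; first exact: diff_times0.
  have dr : diff_times E n.+1 r := diff_timesS oE rl IHn.
  have dl := (smooth_diff_times _ _).1 sl n.+1.
  have rD t : E t -> D (r t) by move=> /rP[].
  apply: (diff_timesV oE (f := l \o r)) => [t /rD/l0//|].
  exact: diff_times_comp oE oD rD dr dl.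
- by move=> t Et; rewrite invr_neq0// l0//; have [] := rP t Et.
- split=> [t /rP[]//|t t' + + rtt'|s Ds].
    by rewrite !inE => /rP[_ <-] /rP[_ <-]; rewrite rtt'.
  by exists (p s); [apply: pD|apply: rK].
Qed.

Lemma diffeomorphic_can D E (lambda phi psi : R -> R) :
  smooth_on D lambda -> (forall s, D s -> lambda s != 0) ->
  (forall s, D s -> is_derive s 1 phi (lambda s)) ->
  (forall s, D s -> E (phi s) /\ psi (phi s) = s) ->
  (forall t, E t -> D (psi t) /\ phi (psi t) = t) -> diffeomorphic D E.
Proof.
move=> sl l0 pl pK qK; exists lambda, phi; split=> //.
split=> [s /pK[]//|s s' + + pss'|t /qK[Dt pt]]; last by exists (psi t).
by rewrite !inE => /pK[_ <-] /pK[_ <-]; rewrite pss'.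
Qed.

Let is_derive_subl (b s : R) : is_derive s (1 : R) (fun x : R => b - x) (-1).
Proof.
by apply: is_derive_eq (is_deriveB (is_derive_cst b s 1) (is_derive_id s 1)) _;
  rewrite sub0r.
Qed.

Let itv_pos (x : R) : (`]0%R, +oo[ : set R) x = (0 < x) :> Prop.
Proof. by rewrite /= in_itv /= andbT. Qed.

Lemma diffeomorphic_setT : diffeomorphic [set: R] `]0%R, +oo[.
Proof.
apply: (diffeomorphic_can (lambda := @expR R) (phi := @expR R)
  (psi := @ln R)).
- exact/smooth_on_expR/openT.
- by move=> s _; rewrite gt_eqF ?expR_gt0.
- by move=> s _; rewrite itv_pos expR_gt0 expRK.
- by move=> t; rewrite itv_pos => t0; split=> //; rewrite lnK.
Qed.

Lemma diffeomorphic_itvoy (a : R) : diffeomorphic `]a, +oo[ `]0%R, +oo[.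
Proof.
apply: (diffeomorphic_can (lambda := cst 1) (phi := fun s => s - a)
  (psi := fun t => t + a)).
- apply/smooth_diff_times => n; apply: diff_times_cst; exact: interval_open.
- by move=> s _; exact: oner_neq0.
- by move=> s _; apply: is_derive_eq; rewrite subr0.
- by move=> s; rewrite !itv_pos /= in_itv /= andbT subr_gt0 subrK.
- by move=> t; rewrite !itv_pos /= in_itv /= andbT ltrDr addrK.
Qed.

Lemma diffeomorphic_itvNyo (b : R) : diffeomorphic `]-oo, b[ `]0%R, +oo[.
Proof.
apply: (diffeomorphic_can (lambda := cst (-1)) (phi := fun s => b - s)
  (psi := fun t => b - t)).
- apply/smooth_diff_times => n; apply: diff_times_cst; exact: interval_open.
- by move=> s _; rewrite oppr_eq0 oner_neq0.
- by move=> s _; exact: is_derive_subl.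
- by move=> s; rewrite !itv_pos /= in_itv /= subr_gt0 subKr.
- by move=> t; rewrite !itv_pos /= in_itv /= gtrBl subKr.
Qed.

Lemma diffeomorphic_itvoo (a b : R) : a < b ->
  diffeomorphic `]a, b[ `]0%R, +oo[.
Proof.
move=> ab; have oab : open `]a, b[ by exact: interval_open.
have ab0 : b - a != 0 by rewrite subr_eq0 gt_eqF.
apply: (diffeomorphic_can
  (lambda := fun s => (b - a) * ((b - s)^-1 * (b - s)^-1))
  (phi := fun s => (s - a) / (b - s))
  (psi := fun t => (a + b * t) / (1 + t))).
- apply/smooth_diff_times => n.
  have dI : diff_times `]a, b[ n (fun s => (b - s)^-1).
    apply: diff_timesV => // [s|].
      by rewrite /= in_itv/= => /andP[_ sb]; rewrite subr_eq0 gt_eqF.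
    have dN : diff_times `]a, b[ n (cst (-1) : R -> R).
      exact: diff_times_cst.
    exact: diff_timesW (diff_timesS oab (fun s _ => is_derive_subl b s) dN).
  have dc : diff_times `]a, b[ n (cst (b - a) : R -> R).
    exact: diff_times_cst.
  exact: (diff_timesM oab dc (diff_timesM oab dI dI)).
- move=> s; rewrite /= in_itv/= => /andP[_ sb].
  by rewrite !mulf_neq0// invr_neq0// subr_eq0 gt_eqF.
- move=> s; rewrite /= in_itv/= => /andP[_ sb].
  have sb0 : b - s != 0 by rewrite subr_eq0 gt_eqF.
  have dsub : is_derive s (1 : R) (fun x : R => x - a) (1 - 0) := is_deriveB
    (is_derive_id s 1) (is_derive_cst a s 1).
  have dq := is_deriveM dsub
    (is_deriveV (f := fun x => b - x) sb0 (is_derive_subl b s)).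
  apply: (is_derive_eq dq); rewrite /GRing.scale/=.
  by field.
- move=> s; rewrite !itv_pos /= in_itv /= => /andP[a_s sb].
  have sb0 : b - s != 0 by rewrite subr_eq0 gt_eqF.
  rewrite divr_gt0 ?subr_gt0//; split=> //; field.
  by rewrite sb0 /=; apply: contra ab0 => /eqP h; apply/eqP; lra.
- move=> t; rewrite !itv_pos /= in_itv /= => t0.
  have t1 : 0 < 1 + t by rewrite addr_gt0.
  split; first by rewrite ltr_pdivlMr// ltr_pdivrMr//; apply/andP; split; nra.
  field; rewrite gt_eqF//=; apply: contra ab0 => /eqP h; apply/eqP; lra.
Qed.

(** Openness only excludes closed ends; taking interiors normalizes every
    interval to one of four shapes, or to the empty set when an infinite end is
    on the wrong side. *)
Lemma open_itv_diffeomorphic_pos (I : interval R) :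
  open [set` I] -> [set` I] !=set0 -> diffeomorphic [set` I] `]0%R, +oo[.
Proof.
move=> /interior_id <-.
case: I => -[x a|[]] [y b|[]]; rewrite ?interior_itv.
- move=> [s]; rewrite /= in_itv/= => /andP[a_s sb].
  exact/diffeomorphic_itvoo/(lt_trans a_s).
- by move=> [s /interior_subset]; rewrite /= in_itv/= [_ && _]andbC.
- by move=> _; exact: diffeomorphic_itvoy.
- by move=> _; exact: diffeomorphic_itvNyo.
- by move=> [s /interior_subset]; rewrite /= in_itv/=.
- by move=> _; rewrite set_itvNyy; exact: diffeomorphic_setT.
- by move=> [s /interior_subset]; rewrite /= in_itv/=.
- by move=> [s /interior_subset]; rewrite /= in_itv/=.
- by move=> [s /interior_subset]; rewrite /= in_itv/=.
Qed.

Lemma open_itv_diffeomorphic (I J : interval R) :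
  open [set` I] -> [set` I] !=set0 -> open [set` J] -> [set` J] !=set0 ->
  diffeomorphic [set` I] [set` J].
Proof.
move=> oI I0 oJ J0.
have op : open (`]0%R, +oo[ : set R) by exact: interval_open.
apply: (diffeomorphic_trans oI op (open_itv_diffeomorphic_pos oI I0)).
exact: diffeomorphic_sym oJ op (open_itv_diffeomorphic_pos oJ J0).
Qed.

End Diffeomorphic.

(** * Matrix-valued functions *)

Section ConstantMatrix.
Variable R : realType.

Lemma is_derive_mxP m n (M : R -> 'M[R]_(m, n)) (s : R) dM :
  is_derive s (1 : R) M dM <->
  forall i j, is_derive s (1 : R) (fun t => M t i j) (dM i j).
Proof.
split=> [[dv <-] i j|Mij].
  split; first exact: (derivable_mxP _ _ _).1 dv i j.
  by rewrite derive_mx// mxE.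
have dv : derivable M s 1 by apply/derivable_mxP => i j; case: (Mij i j).
split=> //; rewrite derive_mx//; apply/matrixP => i j; rewrite mxE.
by case: (Mij i j).
Qed.

Lemma is_derive_mulmxr m n p (M : R -> 'M[R]_(m, n)) (s : R) dM
    (G : 'M[R]_(n, p)) :
  is_derive s (1 : R) M dM ->
  is_derive s (1 : R) (fun t => M t *m G) (dM *m G).
Proof.
move=> /is_derive_mxP Mij; apply/is_derive_mxP => i j.
rewrite mxE.
under [X in is_derive _ _ X _]eq_fun do rewrite mxE.
have -> : (fun t => \sum_k M t i k * G k j) =
          \sum_k (fun t => M t i k * G k j).
  by apply/funext => t; rewrite fct_sumE.
apply: is_derive_sum => k.
have dMG := is_deriveM (Mij i k) (is_derive_cst (G k j) s (1 : R)).
by apply: (is_derive_eq dMG); rewrite scaler0 add0r /GRing.scale /= mulrC.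
Qed.

Lemma derive1_mulmxr m n p (M : R -> 'M[R]_(m, n)) (s : R)
    (G : 'M[R]_(n, p)) :
  derivable M s 1 -> (fun t => M t *m G)^`() s = M^`()%classic s *m G.
Proof.
by move=> /derivable_is_derive1 /is_derive_mulmxr dM; apply: is_derive_derive1.
Qed.

Lemma smooth_on_mulmxr m n p (D : set R) (M : R -> 'M[R]_(m, n))
    (G : 'M[R]_(n, p)) :
  open D -> smooth_on D M -> smooth_on D (fun t => M t *m G).
Proof.
move=> oD /smooth_diff_times dM; apply/smooth_diff_times => k.
elim: k M {dM}(dM k) => [M _|k IHk M]; first exact: diff_times0.
move=> /diff_timesSP[MM' dM'].
apply: (diff_timesS oD _ (IHk _ dM')) => s Ds.
exact: is_derive_mulmxr (MM' s Ds).
Qed.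

Lemma derive1_eq0_itv_cst m n (I : interval R) (M : R -> 'M[R]_(m, n)) s t :
  {in I, forall x, is_derive x (1 : R) M 0} -> s \in I -> t \in I ->
  M s = M t.
Proof.
move=> dM; wlog st : s t / s <= t => [H sI tI|sI tI].
  by have [/H|/ltW/H] := leP s t; [apply|move=> h; rewrite h].
have stI x : x \in `[s, t]%R -> x \in I.
  rewrite in_itv/= => /andP[sx xt].
  by have := @interval_is_interval _ I; apply; [exact: sI|exact: tI|rewrite sx].
apply/matrixP => i j.
have dMij x : x \in `[s, t]%R -> is_derive x (1 : R) (fun x => M x i j) 0.
  by move=> /stI/dM/is_derive_mxP/(_ i j); rewrite mxE.
apply/esym/eqP; rewrite -subr_eq0; apply/eqP.
have dMoo x : x \in `]s, t[%R ->
    is_derive x (1 : R) (fun x => M x i j) (cst 0 x).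
  by move=> xst; exact: dMij (subset_itv_oo_cc xst).
have cM : {within `[s, t], continuous (fun x => M x i j)}.
  by apply: derivable_within_continuous => x xst; case: (dMij x xst).
by have [c _ ->] := MVT_segment st dMoo cM; rewrite mul0r.
Qed.

End ConstantMatrix.

(** * Lorentz isometries and orthonormal frames *)

Section LorentzMatrix.
Variable R : realType.
Implicit Types (F G : 'M[R]_3) (x y : 'rV[R]_3).

Definition minkowski_mx : 'M[R]_3 :=
  diag_mx (\row_i (if i == 0 then -1 else 1)).
Local Notation J := minkowski_mx.

Lemma lorentzE x y : lorentz x y = (x *m J *m y^T) 0 0.
Proof.
rewrite /lorentz mxE !big_ord_recl big_ord0 /J mul_mx_diag !mxE /=.
have -> : (lift ord0 ord0 : 'I_3) = 1 by apply/val_inj.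
have -> : (lift ord0 (lift ord0 ord0) : 'I_3) = 2 by apply/val_inj.
by rewrite /= !mulrN1 !mulr1 mulNr addr0 addrA.
Qed.

Lemma lorentz_isometry_mx F : lorentz_isometry F <-> F *m J *m F^T = J.
Proof.
split=> [isoF|FJ x y]; last first.
  by rewrite !lorentzE trmx_mul -!mulmxA [F *m (_ *m _)]mulmxA
     [F *m _ *m (_ *m _)]mulmxA FJ !mulmxA.
have entry (A : 'M[R]_3) i j :
  A i j = ((delta_mx 0 i : 'rV[R]_3) *m A *m (delta_mx 0 j : 'rV[R]_3)^T) 0 0.
  by rewrite -rowE trmx_delta -colE !mxE.
apply/matrixP => i j; rewrite (entry (_ *m _)) (entry J) -lorentzE -isoF.
by rewrite lorentzE trmx_mul !mulmxA.
Qed.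

Lemma lorentz_isometry_det F : lorentz_isometry F -> \det F ^+ 2 = 1.
Proof.
move=> /lorentz_isometry_mx /(congr1 determinant).
rewrite !det_mulmx det_tr mulrAC -expr2 => /eqP.
have J0 : \det J != 0.
  rewrite det_diag; apply/prodf_neq0 => i _; rewrite mxE.
  by case: ifP; rewrite ?oppr_eq0 oner_neq0.
by rewrite -subr_eq0 -{2}[\det J]mul1r -mulrBl mulf_eq0 (negPf J0) orbF
  subr_eq0 => /eqP.
Qed.

Lemma lorentz_isometry_unit F : lorentz_isometry F -> F \in unitmx.
Proof.
move=> /lorentz_isometry_det dF; rewrite unitmxE unitfE.
by apply/eqP => d0; move: dF; rewrite d0 expr0n /= => /esym/eqP; rewrite oner_eq0.
Qed.

Lemma lorentz_isometry_mul F G :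
  lorentz_isometry F -> lorentz_isometry G -> lorentz_isometry (F *m G).
Proof. by move=> isoF isoG x y; rewrite !mulmxA isoG isoF. Qed.

Lemma lorentz_isometry_inv F : lorentz_isometry F -> lorentz_isometry (invmx F).
Proof.
move=> isoF x y; rewrite -isoF !mulmxKV//; exact: lorentz_isometry_unit.
Qed.

(** The timelike vector has to be the first argument, since coordinate 0 is the
    timelike one: then the Gram matrix of the rows is minkowski_mx itself. *)
Definition frame_mx x y z : 'M[R]_3 :=
  \matrix_(i < 3) nth 0 [:: x; y; z] i.

(** The (i, j) entry of A J A^T is the Lorentz product of rows i and j of A, so
    orthonormality of the rows is exactly the matrix equation for an
    isometry. *)
Lemma orthonormal_frame_isometry (h q a : 'rV[R]_3) :
  lorentz h h = -1 -> lorentz q q = 1 -> lorentz a a = 1 ->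
  lorentz q h = 0 -> lorentz q a = 0 -> lorentz h a = 0 ->
  lorentz_isometry (frame_mx h q a).
Proof.
move=> hh qq aa qh qa ha; apply/lorentz_isometry_mx.
have sym x y : lorentz x y = lorentz y x.
  by rewrite /lorentz; ring.
have entry (A : 'M[R]_3) i j : (A *m J *m A^T) i j = lorentz (row i A) (row j A).
  by rewrite lorentzE tr_row colE mulmxA -!row_mul -colE !mxE.
apply/matrixP => i j; rewrite entry !rowK.
case: i => -[|[|[|//]]] /= ?; case: j => -[|[|[|//]]] /= ?; rewrite !mxE/=.
all: by rewrite ?mulr0n ?mulr1n// sym.
Qed.

(** Since q is the same row in the frames (h, q, a) and (h, q, - a), and one of
    these has determinant 1, q is the image of the standard vector e_1 under an
    isometry of determinant 1; any two such q are then related by one. *)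
Lemma exists_frame_isometry (h q a : 'rV[R]_3) :
  lorentz h h = -1 -> lorentz q q = 1 -> lorentz a a = 1 ->
  lorentz q h = 0 -> lorentz q a = 0 -> lorentz h a = 0 ->
  exists F, [/\ lorentz_isometry F, \det F = 1 &
                (delta_mx 0 1 : 'rV[R]_3) *m F = q].
Proof.
move=> hh qq aa qh qa ha.
have isoF := orthonormal_frame_isometry hh qq aa qh qa ha.
have e1 z : (delta_mx 0 1 : 'rV[R]_3) *m frame_mx h q z = q by rewrite -rowE rowK.
have := lorentz_isometry_det isoF.
move=> /eqP; rewrite sqrf_eq1 => /orP[]/eqP dF.
  by exists (frame_mx h q a).
exists (frame_mx h q (- a)); split=> //.
  have lN x y : lorentz x (- y) = - lorentz x y by rewrite /lorentz !mxE; ring.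
  have Nl x y : lorentz (- x) y = - lorentz x y by rewrite /lorentz !mxE; ring.
  by apply: orthonormal_frame_isometry; rewrite ?lN ?Nl ?opprK ?qa ?ha ?oppr0.
(* Negating the last row negates the determinant. *)
have rowN : row' 2 (frame_mx h q a) = row' 2 (frame_mx h q (- a)).
  by apply/matrixP => -[[|[|//]] ?] j; rewrite !mxE.
have := @determinant_multilinear _ _ (frame_mx h q (- a)) _ _ 2 (-1) 0
  _ rowN rowN.
rewrite dF mul0r addr0 mulrNN mulr1; apply.
by rewrite !rowK /= scale0r addr0 scaleN1r.
Qed.

End LorentzMatrix.

(** * Isometries acting on ruled surfaces *)

Section MoveSurface.
Variables (R : realType) (G : 'M[R]_3) (S : ruled_surface R).
Hypotheses (isoG : lorentz_isometry G) (ruledS : spacelike_ruled S).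

Lemma rs_ds_move s v : s \in rs_dom S ->
  rs_ds (rs_move G S) s v = rs_ds S s v *m G.
Proof.
case: ruledS => _ [sc sq _ _] _ _ _ sS.
have dS : derivable (fun t => rs_map S t v) s 1.
  apply: derivableD; first exact: smooth_on_derivable sc sS.
  exact/derivableZ/(smooth_on_derivable sq sS).
rewrite -(derive1_mulmxr G dS) /rs_ds; congr (derive1 _ s).
by apply/funext => t; rewrite /rs_map /= mulmxDl scalemxAl.
Qed.

Lemma is_derive_rs_dv s v : is_derive v (1 : R) (rs_map S s) (rs_q S s).
Proof.
apply/is_derive_mxP => i j; rewrite /rs_map.
under [X in is_derive _ _ X _]eq_fun do rewrite !mxE.
have dw := is_deriveD (is_derive_cst (rs_base S s i j) v (1 : R))
  (is_deriveM (is_derive_id v (1 : R)) (is_derive_cst (rs_q S s i j) v (1 : R))).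
by apply: (is_derive_eq dw); rewrite scaler0 !add0r /GRing.scale /= mulr1.
Qed.

Lemma rs_dv_move s v : rs_dv (rs_move G S) s v = rs_dv S s v *m G.
Proof.
have [dS _] := is_derive_rs_dv s v.
rewrite -(derive1_mulmxr G dS) /rs_dv; congr (derive1 _ v).
by apply/funext => t; rewrite /rs_map /= mulmxDl scalemxAl.
Qed.

(** The regularity condition is a rank condition, which survives because an
    isometry is invertible; the arc-length, striction and frame conditions
    survive because it preserves Lorentz products; the Frenet equations because
    it is linear. *)
Lemma spacelike_ruled_move : spacelike_ruled (rs_move G S).
Proof.
case: (ruledS) => -[oS nS] [sc sq sh sa] [regS strS] frameS frenetS.
have unitG := lorentz_isometry_unit isoG.
have dG (f : R -> 'rV[R]_3) s : smooth_on [set` rs_dom S] f -> s \in rs_dom S ->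
    (fun t => f t *m G)^`()%classic s = f^`()%classic s *m G.
  by move=> sf sS; apply: derive1_mulmxr; exact: smooth_on_derivable sf sS.
split.
- by split.
- by split; [exact: smooth_on_mulmxr oS sc|exact: smooth_on_mulmxr oS sq
            |exact: smooth_on_mulmxr oS sh|exact: smooth_on_mulmxr oS sa].
- split=> [s v sS|s sS].
    rewrite rs_ds_move// rs_dv_move -mul_col_mx /row_free mxrankMfree.
      exact: regS.
    by rewrite row_free_unit.
  rewrite (dG _ _ sc sS) (dG _ _ sq sS) !isoG; exact: strS sS.
- move=> s sS; have [qha ort [hs hv]] := frameS s sS.
  rewrite (rs_ds_move _ sS) rs_dv_move.
  split; [case: qha|case: ort|]; rewrite !isoG; by split.
- move=> s sS; have [qs hs as_] := frenetS s sS.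
  rewrite /= (dG _ _ sq sS) (dG _ _ sh sS) (dG _ _ sa sS).
  by rewrite qs hs as_ mulmxDl -!scalemxAl.
Qed.

End MoveSurface.

(** * Cylinders *)

Lemma cylindrical_ruling_cst (R : realType) (S : ruled_surface R) s t :
  spacelike_ruled S -> cylindrical S -> s \in rs_dom S -> t \in rs_dom S ->
  rs_q S s = rs_q S t.
Proof.
move=> [_ [_ sq _ _] _ _ frenetS] cylS; apply: derive1_eq0_itv_cst => x xS.
have := derivable_is_derive1 (smooth_on_derivable sq xS).
by have [-> _ _] := frenetS x xS; rewrite cylS// scale0r.
Qed.

Theorem corollary5p1 (R : realType) (Sa Sb : ruled_surface R)
    (hSa : spacelike_ruled Sa) (hSb : spacelike_ruled Sb)
    (cyla : cylindrical Sa) (cylb : cylindrical Sb) :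
  exists G : 'M[R]_3,
    [/\ lorentz_isometry G, \det G = 1 & spacelike_similar (rs_move G Sa) Sb].
Proof.
have isometry_of S s : spacelike_ruled S -> s \in rs_dom S -> exists F,
    [/\ lorentz_isometry F, \det F = 1 &
        (delta_mx 0 1 : 'rV[R]_3) *m F = rs_q S s].
  move=> [_ _ _ frameS _] /frameS[[qq hh aa] [qh qa ha] _].
  exact: exists_frame_isometry hh qq aa qh qa ha.
(* s0 and t0 serve to read off the two constant rulings; phi need not match
   them. *)
have [[oa [s0 s0a]] _ _ _ _] := hSa.
have [[ob [t0 t0b]] _ _ _ _] := hSb.
have [Fa [isoa deta qa]] := isometry_of _ _ hSa s0a.
have [Fb [isob detb qb]] := isometry_of _ _ hSb t0b.
have isoG := lorentz_isometry_mul (lorentz_isometry_inv isoa) isob.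
exists (invmx Fa *m Fb); split; first exact: isoG.
  by rewrite det_mulmx det_inv deta detb invr1 mulr1.
split; [exact: spacelike_ruled_move|exact: hSb|].
have [l [p [sl l0 pl bp]]] :=
  open_itv_diffeomorphic ob (ex_intro _ t0 t0b) oa (ex_intro _ s0 s0a).
exists l, p; split; first by split.
move=> t tb.
have pa : p t \in rs_dom Sa by case: bp => + _ _; apply.
rewrite /= (cylindrical_ruling_cst hSa cyla pa s0a) -qa mulmxA mulmxK.
  by rewrite qb; exact: cylindrical_ruling_cst hSb cylb t0b tb.
exact: lorentz_isometry_unit isoa.
Qed.
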